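(* Let $n,w,t$ be nonnegative integers with $t+w\le n\le 2w+t$, and let $q\ge 3$. Define $$A''_q(n,w,t)=\{(0,\dots,0,a_{t+1},\dots,a_n)\in\mathbb{Z}_q^n:\ \mathrm{wt}((a_{t+1},\dots,a_n))=w\}$$ (the first $t$ coordinates are $0$). Then: (1'') $A''_q(n,w,t)$ is an anticode of diameter $n-t$ in $J_q(n,w)$; (2'') $|A''_q(n,w,t)|=\binom{n-t}{w}(q-1)^w$; (3'') if $n\ge (n-w-t+1)(t+1)$ (equivalently $n\le (w+t-1)(t+1)/t$), then for all sufficiently large $q$, $A''_q(n,w,t)$ is a maximum anticode of diameter $n-t$ in $J_q(n,w)$.
   Context: $\mathbb{Z}_q=\{0,1,\dots,q-1\}$ is used merely as an alphabet. For $x\in\mathbb{Z}_q^n$, $\mathrm{supp}(x)=\{i\in[n]: x_i\ne 0\}$ and $\mathrm{wt}(x)=|\mathrm{supp}(x)|$; $d(x,y)$ is the Hamming distance. $J_q(n,w)$ denotes the set of words of $\mathbb{Z}_q^n$ of weight $w$, with the Hamming metric. An anticode of diameter $D$ is a nonempty subset in which all pairwise distances are at most $D$; it is maximum if it has the largest cardinality among all anticodes of diameter $D$ in the space. *)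

(* Defs.v *)
From mathcomp Require Import all_boot.
Set Implicit Arguments. Unset Strict Implicit. Unset Printing Implicit Defensive.

(* Words of Z_q^n : finite functions 'I_n -> 'I_q; Z_q is only an alphabet,
   and the symbol 0 is the ordinal with value 0. *)
Definition word (q n : nat) := {ffun 'I_n -> 'I_q}.

Definition supp (q n : nat) (x : word q n) : {set 'I_n} :=
  [set i | nat_of_ord (x i) != 0].
Definition wt (q n : nat) (x : word q n) : nat := #|supp x|.

Definition hdist (q n : nat) (x y : word q n) : nat := #|[set i | x i != y i]|.

Definition Jq (q n w : nat) : {set word q n} := [set x | wt x == w].

Definition is_anticode (q n : nat) (S A : {set word q n}) (D : nat) : Prop :=
  [/\ A != set0, A \subset S &
      forall x y, x \in A -> y \in A -> hdist x y <= D].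

Definition is_max_anticode (q n : nat) (S A : {set word q n}) (D : nat) : Prop :=
  is_anticode S A D /\
  forall B : {set word q n}, is_anticode S B D -> #|B| <= #|A|.

(* weight of the tail (a_{t+1},...,a_n), i.e. coordinates with index >= t
   (0-based indices) *)
Definition tail_wt (q n t : nat) (x : word q n) : nat :=
  #|[set i : 'I_n | (t <= i) && (nat_of_ord (x i) != 0)]|.

Definition App (q n w t : nat) : {set word q n} :=
  [set x : word q n | [forall i : 'I_n, (i < t) ==> (nat_of_ord (x i) == 0)]
                      && (tail_wt t x == w)].

(* Main.v *)
Require Import Defs.
From mathcomp Require Import all_boot perm zify.
Set Implicit Arguments. Unset Strict Implicit. Unset Printing Implicit Defensive.

(* Two words at distance at most n - t agree in at least t places. Call a support S large
   for an anticode B when more than w (q-1)^(w-1) words of B have support S. Given any y in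
   B, some word of B with a large support S disagrees with y on all of S, so the complements
   of S and of supp y share at least t points. Hence the complements of the large supports,
   together with at most one further support, form a t-intersecting family of (n-w)-sets,
   which has at most C(n-t, w) members by the exact Erdos-Ko-Rado theorem. Either every
   support is large, and the bound is immediate, or there are fewer than C(n-t, w) large
   supports, and the words with other supports are negligible for large q.

   The Erdos-Ko-Rado bound is obtained by the generating set method of Ahlswede and
   Khachatryan. A t-intersecting family U of subsets of the first m = s+1 points is weighted
   by the number of k-sets whose trace lies in U. After shifting s to smaller points, two
   members of U that cannot both lose s meet in exactly t points and cover all the m points,
   so their sizes add up to m + t. Pairing the sizes i and m + t - i, one can choose the
   members that lose s without decreasing the weight, and so descend from m = n to m = t. *)

(** * Extension numbers *)

(* The number of k-sets extending a fixed i-set by elements of a disjoint N-set;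
   the test is needed because [k - i] is truncated. *)
Definition ext N k i := if i <= k then 'C(N, k - i) else 0.

Lemma ext_pascal N k i : ext N.+1 k i = ext N k i + ext N k i.+1.
Proof.
rewrite /ext; case: (ltngtP i k) => [lt_ik||->]; rewrite ?subnn ?bin0 ?ltnn //.
by rewrite subnS; case: (k - i) (subn_gt0 i k) => [|d _]; rewrite ?lt_ik // binS.
Qed.

(** Both sides count the extensions with one marked new point. *)
Lemma ext_diag N k i : (k - i) * ext N.+1 k i = N.+1 * ext N k i.+1.
Proof.
rewrite /ext; case: (ltngtP i k) => [lt_ik|lt_ki|->]; rewrite ?subnn ?muln0 //.
have ->: k - i = (k - i.+1).+1 by lia.
by rewrite -mul_bin_diag.
Qed.

(** If the left side [S] exceeded both products, their sum with weights [k - i] and [k - j] would be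
    less than [N.+1 * S], while [ext_diag] makes it equal to [N.+1 * S]. A size of at least [k]
    makes its term on the left vanish. *)
Lemma ext_pair N k i j a b : k - i + (k - j) <= N.+1 \/ k <= i \/ k <= j ->
  a * ext N k i.+1 + b * ext N k j.+1 <= maxn (a * ext N.+1 k i) (b * ext N.+1 k j).
Proof.
have ext0 l : k <= l -> ext N k l.+1 = 0 by move=> h; rewrite /ext ltnNge h.
have Hi := ext_diag N k i; have Hj := ext_diag N k j.
have Li : ext N k i.+1 <= ext N.+1 k i by rewrite (ext_pascal N k i) leq_addl.
have Lj : ext N k j.+1 <= ext N.+1 k j by rewrite (ext_pascal N k j) leq_addl.
move=> H.
have [ki|ik] := leqP k i.
  by rewrite ext0 // muln0 add0n leq_max (leq_mul2l b) Lj !orbT.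
have [kj|jk] := leqP k j.
  by rewrite (ext0 j) // muln0 addn0 leq_max (leq_mul2l a) Li !orbT.
have {}H : k - i + (k - j) <= N.+1 by case: H => //; lia.
rewrite leqNgt gtn_max; apply/negP => /andP[].
set S := (_ + _) => h1 h2.
have : (k - i) * (a * ext N.+1 k i) + (k - j) * (b * ext N.+1 k j) <
       (k - i) * S + (k - j) * S.
  by rewrite -addSn leq_add // ?ltn_pmul2l ?leq_pmul2l ?subn_gt0 // ltnW.
rewrite mulnCA Hi (mulnCA _ b) Hj -mulnDl ltnNge; case/negP.
rewrite (mulnCA a) (mulnCA b) -mulnDr.
exact: leq_mul.
Qed.

(** * Shifting *)

Definition t_intersecting (T : finType) t (U : {set {set T}}) :=
  forall A B, A \in U -> B \in U -> t <= #|A :&: B|.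

Section Shift.
Variables (T : finType) (l s : T) (U : {set {set T}}).

Definition swap (A : {set T}) : {set T} := tperm l s @: A.

Definition moved (A : {set T}) := [&& s \in A, l \notin A & swap A \notin U].

Definition shift (A : {set T}) := if moved A then swap A else A.

Lemma in_swap (A : {set T}) x : (x \in swap A) = (tperm l s x \in A).
Proof. by rewrite -{1}(tpermK l s x) mem_imset //; exact: perm_inj. Qed.

Lemma swapK : involutive swap.
Proof. by move=> A; apply/setP=> x; rewrite !in_swap tpermK. Qed.

Lemma card_swap A : #|swap A| = #|A|.
Proof. by rewrite card_imset //; exact: perm_inj. Qed.

Lemma swapI A B : swap (A :&: B) = swap A :&: swap B.
Proof. by apply/setP=> x; rewrite !(in_swap, inE). Qed.

Lemma card_shift A : #|shift A| = #|A|.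
Proof. by rewrite /shift; case: ifP; rewrite ?card_swap. Qed.

Lemma shift_inj : {in U &, injective shift}.
Proof.
move=> A B AU BU; rewrite /shift.
case: ifP => [/and3P[_ _ mA]|_]; case: ifP => [/and3P[_ _ mB]|_] //.
- exact: can_inj swapK _ _.
- by move=> E; rewrite E BU in mA.
- by move=> E; rewrite -E AU in mB.
Qed.

(** The one delicate case is [A] moved and [B] not. If [B] stays because [swap B] is already in [U],
    compare [A] with [swap B]; if [B] contains both or neither of [l] and [s], it is fixed by the
    swap; otherwise [B] misses [s], and swapping [A] loses no common point. *)
Lemma shift_t_intersecting t : t_intersecting t U -> t_intersecting t (shift @: U).
Proof.
move=> tU.
have half A B : A \in U -> B \in U -> moved A -> ~~ moved B -> t <= #|swap A :&: B|.
  move=> AU BU /and3P[sA lA mA] mB.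
  have [/and3P[sB lB]|] := boolP [&& s \in B, l \notin B & swap B \in U].
    by move=> sBU; rewrite -card_swap swapI swapK tU.
  rewrite !negb_and => nB.
  have [eq_sl|ne_sl] := boolP ((s \in B) == (l \in B)).
    have -> : B = swap B.
      apply/setP => x; rewrite in_swap; case: tpermP => // ->; by rewrite (eqP eq_sl).
    by rewrite -swapI card_swap tU.
  have sB : s \notin B.
    apply/negP=> sB; move: mB nB ne_sl; rewrite /moved sB /=.
    by case: (l \in B) => //=; case: (swap B \in U).
  apply: leq_trans (tU A B AU BU) (subset_leq_card _).
  apply/subsetP=> x; rewrite !inE in_swap => /andP[xA xB]; rewrite xB andbT.
  by case: tpermP xA xB => // -> _ xB; rewrite xB in sB.
move=> _ _ /imsetP[A AU ->] /imsetP[B BU ->]; rewrite /shift.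
case: ifP => mA; case: ifP => mB; last exact: tU.
- by rewrite -swapI card_swap tU.
- by apply: half; rewrite ?mB.
- by rewrite setIC; apply: half; rewrite ?mA.
Qed.

Lemma shift_sum (f : nat -> nat) :
  \sum_(A in shift @: U) f #|A| = \sum_(A in U) f #|A|.
Proof.
rewrite big_imset /=; last exact: shift_inj.
by apply: eq_bigr => A _; rewrite card_shift.
Qed.

(** This is the termination measure for repeated shifting: a shifted set that contains [s] is an
    unmoved member of [U], and [A0] is lost. *)
Lemma shift_mem_count A0 : A0 \in U -> moved A0 ->
  #|[set A in shift @: U | s \in A]| < #|[set A in U | s \in A]|.
Proof.
move=> A0U mA0; apply: proper_card; apply/properP; split.
  apply/subsetP=> _ /setIdP[/imsetP[A AU ->]]; rewrite /shift inE.
  by case: ifP => [/and3P[_ lA _]|_ ->]; rewrite ?AU // in_swap tpermR (negPf lA).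
exists A0; first by rewrite inE A0U; case/and3P: mA0.
rewrite inE; apply/negP=> /andP[/imsetP[A AU eA] sA0].
move: eA; rewrite /shift; case: ifP => [mA eA|mA eA]; last by rewrite -eA mA0 in mA.
by move: sA0 mA; rewrite eA in_swap tpermR /moved => ->; rewrite andbF.
Qed.

End Shift.

Definition initseg n m : {set 'I_n} := [set i : 'I_n | i < m].

Lemma card_initseg n m : m <= n -> #|initseg n m| = m.
Proof.
move=> le_mn; rewrite /initseg cardsE -sum1_card.
by rewrite (big_ord_narrow le_mn) sum1_card card_ord.
Qed.

(* The number of k-subsets of ['I_n] whose trace on the first m points is in [U]. *)
Definition weight n k m (U : {set {set 'I_n}}) := \sum_(E in U) ext (n - m) k #|E|.

Lemma exists_shifted n t (s : 'I_n) (U : {set {set 'I_n}}) :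
  t_intersecting t U -> {in U, forall E : {set 'I_n}, E \subset initseg n s.+1} ->
  exists V : {set {set 'I_n}},
    [/\ t_intersecting t V, {in V, forall E : {set 'I_n}, E \subset initseg n s.+1},
        forall k, weight k s.+1 V = weight k s.+1 U &
        forall (l : 'I_n) E, l < s -> E \in V -> s \in E -> l \notin E -> swap l s E \in V].
Proof.
have [c] := ubnP #|[set E in U | s \in E]|; elim: c U => // c IHc U lt_c tU subU.
have [|/existsPn noM] := boolP [exists p : 'I_n * {set 'I_n},
    [&& p.1 < s, p.2 \in U & moved p.1 s U p.2]]; last first.
  exists U; split=> // l E ls EU sE lE; apply/negPn/negP => nE.
  by have := noM (l, E); rewrite /= ls EU /moved sE lE nE.
case/existsP=> -[l E0] /= /and3P[ls E0U mE0].
have [|||V [tV subV wV shV]] := IHc (shift l s U @: U).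
- by apply: leq_trans (shift_mem_count E0U mE0) _; rewrite -ltnS.
- exact: shift_t_intersecting.
- move=> _ /imsetP[E EU ->]; rewrite /shift; case: ifP => _; last exact: subU.
  apply/subsetP=> x; rewrite in_swap => xE; have := subsetP (subU _ EU) _ xE.
  by rewrite !inE; case: tpermP => // ->; lia.
exists V; split=> // k; rewrite wV; exact: (shift_sum _ _ _ (fun i => ext _ k i)).
Qed.

(** * Removing the last point *)

Definition boundary n (s : 'I_n) (U : {set {set 'I_n}}) :=
  [set E in U | (s \in E) && (E :\ s \notin U)].

(** Members containing [s] but outside [H] disappear; those outside the boundary leave [E :\ s] in
    the family anyway. *)
Definition drop_last n (s : 'I_n) (U H : {set {set 'I_n}}) : {set {set 'I_n}} :=
  [set E in U | s \notin E] :|: [set E :\ s | E in H].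

Section DropLast.
Variables (n t k : nat) (s : 'I_n) (U : {set {set 'I_n}}).
Hypothesis tU : t_intersecting t U.
Hypothesis subU : {in U, forall E : {set 'I_n}, E \subset initseg n s.+1}.

Lemma drop_last_sub (H : {set {set 'I_n}}) : H \subset U ->
  {in drop_last s U H, forall E : {set 'I_n}, E \subset initseg n s}.
Proof.
move=> HU E; rewrite inE => /orP[/setIdP[EU sE]|/imsetP[F FH ->]].
  apply/subsetP=> x xE; have := subsetP (subU EU) _ xE; rewrite !inE ltnS leq_eqVlt.
  by case/orP=> // /eqP/val_inj xs; rewrite -xs xE in sE.
apply/subsetP=> x /setD1P[xs xF].
have := subsetP (subU (subsetP HU _ FH)) _ xF; rewrite !inE ltnS leq_eqVlt.
by case/orP=> // /eqP/val_inj e; rewrite e eqxx in xs.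
Qed.

(** Deleting [s] from both sets costs one common point, hence [t.+1] on [H]; deleting it from one
    set costs nothing when the other misses [s]. *)
Lemma drop_last_t_intersecting (H : {set {set 'I_n}}) :
  H \subset boundary s U -> t_intersecting t.+1 H ->
  t_intersecting t (drop_last s U H).
Proof.
move=> /subsetP HB tH.
have HU E : E \in H -> E \in U by move/HB/setIdP=> [].
have red E F : E \in U -> s \notin E -> F \in U -> t <= #|E :&: (F :\ s)|.
  move=> EU sE FU; have -> : E :&: (F :\ s) = E :&: F; last exact: tU.
  by rewrite setIDA; apply/setDidPl; rewrite disjoint_sym disjoints1 inE (negPf sE).
move=> E F; rewrite !inE => /orP[/andP[EU sE]|/imsetP[E' E'H ->]]
  /orP[/andP[FU sF]|/imsetP[F' F'H ->]].
- exact: tU.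
- by apply: red => //; exact: HU.
- by rewrite setIC; apply: red => //; exact: HU.
- have := tH _ _ E'H F'H; rewrite (cardsD1 s) !inE.
  case/setIdP: (HB _ E'H) => _ /andP[-> _]; case/setIdP: (HB _ F'H) => _ /andP[-> _].
  by rewrite add1n ltnS => h; rewrite -setDIl.
Qed.

(** By Pascal's rule each member without [s] gains [ext (n - s.+1) k #|E|.+1]. This gain pays for
    the non-boundary members through [s], which [E :\ s] injects into the members without [s]. *)
Lemma weight_drop_last (H : {set {set 'I_n}}) : H \subset boundary s U ->
  weight k s (drop_last s U H) + \sum_(E in boundary s U) ext (n - s.+1) k #|E| >=
  weight k s.+1 U + \sum_(E in H) ext (n - s) k #|E|.-1.
Proof.
move=> /subsetP HB.
have sH E : E \in H -> s \in E by move/HB/setIdP=> [_ /andP[]].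
have cardD1 (E : {set 'I_n}) : s \in E -> #|E :\ s| = #|E|.-1.
  by move=> sE; rewrite (cardsD1 s E) sE.
have Dinj : {in [pred E : {set 'I_n} | s \in E] &, injective (fun E : {set 'I_n} => E :\ s)}.
  by move=> E F sE sF /= e; rewrite -(setD1K sE) -(setD1K sF) e.
have -> : weight k s (drop_last s U H) =
    \sum_(E in U | s \notin E) ext (n - s) k #|E| + \sum_(E in H) ext (n - s) k #|E|.-1.
  rewrite /weight /drop_last (eq_bigl _ _ (fun E => in_setU E _ _)) bigU /=; last first.
    rewrite disjoint_sym disjoint_subset; apply/subsetP=> _ /imsetP[E EH ->].
    rewrite !inE; apply/negP=> /andP[EU _].
    by case/setIdP: (HB _ EH) => _ /andP[_]; rewrite EU.
  congr (_ + _); first by apply: eq_bigl => E; rewrite !inE.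
  rewrite big_imset /=; last by move=> E F /sH sE /sH sF; apply: Dinj.
  by apply: eq_bigr => E /sH sE; rewrite cardD1.
rewrite addnAC leq_add2r.
rewrite /weight (bigID (fun E : {set 'I_n} => s \notin E)) /=.
have -> : n - s = (n - s.+1).+1 by have := ltn_ord s; lia.
have -> : \sum_(E in U | s \notin E) ext (n - s.+1).+1 k #|E| =
   \sum_(E in U | s \notin E) ext (n - s.+1) k #|E| +
   \sum_(E in U | s \notin E) ext (n - s.+1) k #|E|.+1.
  by rewrite -big_split; apply: eq_bigr => E _; rewrite ext_pascal.
rewrite -addnA leq_add2l.
rewrite (bigID (fun E : {set 'I_n} => E :\ s \in U)) /= leq_add //.
  have -> : \sum_(E in U | s \notin E) ext (n - s.+1) k #|E|.+1 =
      \sum_(E in [set E in U | s \notin E]) ext (n - s.+1) k #|E|.+1.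
    by apply: eq_bigl => E; rewrite inE.
  pose V := [set E in U | (s \in E) && (E :\ s \in U)].
  have -> : \sum_(E | (E \in U) && ~~ (s \notin E) && (E :\ s \in U)) ext (n - s.+1) k #|E| =
      \sum_(E in [set E :\ s | E in V]) ext (n - s.+1) k #|E|.+1.
    rewrite big_imset /=; last first.
      by move=> E F /setIdP[_ /andP[sE _]] /setIdP[_ /andP[sF _]]; apply: Dinj.
    apply: eq_big => [E|E]; first by rewrite !inE negbK andbA.
    by rewrite negbK -andbA => /and3P[_ sE _]; rewrite (cardsD1 s E) sE.
  rewrite [X in _ <= X](big_setID [set E :\ s | E in V]) /=.
  suff /setIidPr -> : [set E :\ s | E in V] \subset [set E in U | s \notin E].
    exact: leq_addr.
  by apply/subsetP=> _ /imsetP[E /setIdP[_ /andP[_ EU]] ->]; rewrite !inE EU eqxx.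
by apply: eq_leq; apply: eq_bigl => E; rewrite !inE negbK andbA.
Qed.

End DropLast.

(** * Layer sums and numerical consequences of Wilson's condition *)

Lemma sum_by_card (T : finType) (X : {set {set T}}) (f : nat -> nat) a b :
  {in X, forall E : {set T}, a <= #|E| < b} ->
  \sum_(E in X) f #|E| = \sum_(a <= i < b) #|[set E in X | #|E| == i]| * f i.
Proof.
move=> Xab; transitivity (\sum_(a <= i < b) \sum_(E in X) (#|E| == i) * f i); last first.
  apply: eq_bigr => i _; rewrite -big_distrl /= -sum1dep_card big_mkcondr /=.
  by congr (_ * _); apply: eq_bigr => E _; case: eqP.
rewrite exchange_big /=; apply: eq_bigr => E /Xab Eab.
rewrite (bigD1_seq #|E|) ?mem_index_iota ?iota_uniq //= eqxx mul1n.
by rewrite big1 ?addn0 // => i /negPf; rewrite eq_sym => ->.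
Qed.

Lemma sum_card_avoid (T : finType) (P : {set T}) (X : {set {set T}}) :
  \sum_(x in P) #|[set E in X | x \notin E]| = \sum_(E in X) #|P :\: E|.
Proof.
transitivity (\sum_(x in P) \sum_(E in X) (x \notin E : nat)).
  apply: eq_bigr => x _; rewrite -sum1dep_card big_mkcondr /=.
  by apply: eq_bigr => E _; case: (x \in E).
rewrite exchange_big /=; apply: eq_bigr => E _.
rewrite -sum1_card [RHS](eq_bigl (fun x => (x \in P) && (x \notin E))); last first.
  by move=> x; rewrite !inE andbC.
by rewrite [RHS]big_mkcondr /=; apply: eq_bigr => x _; case: (x \in E).
Qed.

(** This is what [ext_pair] requires of two sizes adding up to [s.+1 + t], each lowered by one. *)
Lemma wilson_pair_bound n t k : 0 < t -> t <= k -> (k - t + 1) * (t + 1) <= n ->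
  2 * k + 1 <= n + t.
Proof.
move=> t0 tk; have [e ->] : exists e, k = t + e by exists (k - t); lia.
by rewrite addKn; nia.
Qed.

(** The averaging inequality for the self-dual layer. It is tight at [i = s = t + 1] with
    [n = (k - t + 1) * (t + 1)]. *)
Lemma wilson_middle_bound n s t k i : 0 < t -> t <= s -> (k - t + 1) * (t + 1) <= n ->
  i.*2 = s.+1 + t -> i <= k -> s * (k - i.-1) <= (s.+1 - i) * (n - s).
Proof.
move=> t0 ts Hn Hi ik.
have [u tE] : exists u, t = u.+1 by exists t.-1; lia.
have [e iE] : exists e, i = t + e.+1 by exists (i - t).-1; lia.
have [c kE] : exists c, k = i + c by exists (k - i); lia.
have sE : s = u + e.*2.+2 by lia.
have -> : k - i.-1 = c.+1 by lia.
have -> : s.+1 - i = e.+1 by lia.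
have {}Hn : (c + e.+1 + 1) * (u.+1 + 1) <= n.
  by rewrite -tE (_ : c + e.+1 + 1 = k - t + 1) //; lia.
have -> : n - s = n - (u + e.*2.+2) by rewrite sE.
rewrite sE; apply: (@leq_trans (e.+1 * ((c + e.+1 + 1) * (u.+1 + 1) - (u + e.*2.+2)))).
  have -> : (c + e.+1 + 1) * (u.+1 + 1) - (u + e.*2.+2) = c * u + 2 * c + e * u + u + 2 by nia.
  nia.
by rewrite leq_mul2l leq_sub2r ?orbT.
Qed.

(** * One descent step, from s+1 points to s points *)

Section Step.
Variables (n t k : nat) (s : 'I_n) (U : {set {set 'I_n}}).
Hypotheses (t_gt0 : 0 < t) (le_ts : t <= s) (le_tk : t <= k).
Hypothesis wilson : (k - t + 1) * (t + 1) <= n.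
Hypothesis tU : t_intersecting t U.
Hypothesis subU : {in U, forall E : {set 'I_n}, E \subset initseg n s.+1}.
Hypothesis shU : forall (l : 'I_n) E,
  l < s -> E \in U -> s \in E -> l \notin E -> swap l s E \in U.

Local Notation G := (boundary s U).
Local Notation N := (n - s.+1).

Let le_s1n : s.+1 <= n. Proof. exact: ltn_ord. Qed.

(** If some [l < s] were in neither set, replacing [s] by [l] in [E] would give a member of [U]
    meeting [F] in only [t - 1] points. The sizes then follow by inclusion-exclusion. *)
Lemma boundary_cover E F : E \in G -> F \in G -> #|E :&: F| <= t ->
  E :|: F = initseg n s.+1 /\ #|E| + #|F| = s.+1 + t.
Proof.
move=> /setIdP[EU /andP[sE nE]] /setIdP[FU /andP[sF nF]] le_t.
have eq_t : #|E :&: F| = t by apply/eqP; rewrite eqn_leq le_t tU.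
suff cov : E :|: F = initseg n s.+1.
  by split=> //; have := cardsUI E F; rewrite cov card_initseg // eq_t.
apply/eqP; rewrite eqEsubset subUset !subU //=; apply/subsetP=> l.
rewrite !inE ltnS leq_eqVlt => /orP[/eqP/val_inj ->|ls]; first by rewrite sE.
apply/negPn/negP; rewrite negb_or => /andP[lE lF].
have := tU (shU ls EU sE lE) FU; rewrite leqNgt; case/negP.
have -> : t = (#|(E :&: F) :\ s|).+1 by rewrite -eq_t (cardsD1 s) !inE sE sF.
rewrite ltnS; apply: subset_leq_card; apply/subsetP=> x; rewrite !inE in_swap.
by case: tpermP => [->|->|/eqP _ /eqP ->] //; rewrite ?(negPf lE) ?(negPf lF) ?andbF.
Qed.

(** For boundary sets of size [i]: [c i] is the weight of one on [s.+1] points, [d i] its weight on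
    [s] points after deleting [s], [a i] their number, and [dual i] the size of a boundary set
    meeting one of them in exactly [t] points. *)
Let c i := ext N k i.
Let d i := ext (n - s) k i.-1.
Let a i := #|[set E in G | #|E| == i]|.
Let dual i := s.+1 + t - i.

Let GU E : E \in G -> E \in U. Proof. by case/setIdP. Qed.

Let card_G E : E \in G -> t <= #|E| < s.+2.
Proof.
move/GU=> EU; rewrite ltnS -[X in _ && (_ <= X)](card_initseg le_s1n).
by rewrite subset_leq_card ?subU // andbT -{1}(setIid E) tU.
Qed.

Let d_diag i : 0 < i -> (k - i.-1) * d i = (n - s) * c i.
Proof. by case: i => // i _; rewrite /d /c /= -(subnSK (ltn_ord s)) ext_diag. Qed.

Let c_pair i : t <= i < s.+2 -> 
  a i * c i + a (dual i) * c (dual i) <= maxn (a i * d i) (a (dual i) * d (dual i)).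
Proof.
have wp := wilson_pair_bound t_gt0 le_tk wilson.
move=> /andP[ti is1]; set j := dual i.
have [i' iE] : exists i', i = i'.+1 by exists i.-1; lia.
have [j' jE] : exists j', j = j'.+1 by exists j.-1; rewrite /j /dual; lia.
have ijE : i'.+1 + j'.+1 = s.+1 + t by rewrite -iE -jE /j /dual; lia.
rewrite /c /d -(subnSK (ltn_ord s)) jE iE /=; apply: ext_pair; lia.
Qed.

(** In the self-dual layer, sets missing a common [l] cannot cover all points, so they may all be
    kept. A good [l] exists by averaging, as each set misses [s.+1 - i] of the first [s] points. *)
Lemma exists_avoided i : i.*2 = s.+1 + t ->
  exists2 l : 'I_n, l < s & a i * c i <= #|[set E in G | (#|E| == i) && (l \notin E)]| * d i.
Proof.
move=> Hi; apply: (@exists_inP _ _ (fun l : 'I_n => a i * c i <= _)).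
apply: contraT => /exists_inPn no_l.
have i_gt0 : 0 < i by lia.
pose X := [set E in G | #|E| == i].
have lt_l l : l \in initseg n s -> #|[set E in X | l \notin E]| * d i < a i * c i.
  rewrite inE => /no_l; rewrite -ltnNge.
  suff -> : [set E in G | (#|E| == i) && (l \notin E)] = [set E in X | l \notin E] by [].
  by apply/setP=> E; rewrite !inE -!andbA.
have sumX : \sum_(E in X) #|initseg n s :\: E| = a i * (s.+1 - i).
  rewrite -sum_nat_const; apply: eq_bigr => E /setIdP[EG /eqP Ei].
  have -> : initseg n s :\: E = initseg n s.+1 :\: E.
    apply/setP=> x; rewrite !inE ltnS; case: ltngtP => // xs.
    by rewrite (val_inj xs); case/setIdP: EG => _ /andP[->].
  have /setIidPr e := subU (GU EG).
  by rewrite cardsD e card_initseg // Ei.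
have lt_sum : s * (a i * c i) > a i * (s.+1 - i) * d i.
  rewrite -sumX -sum_card_avoid big_distrl /=.
  have -> : s * (a i * c i) = \sum_(l in initseg n s) a i * c i.
    by rewrite sum_nat_const card_initseg // ltnW.
  have s_gt0 : 0 < s by lia.
  (* The point 0 makes the sum over [l] nonempty, so that the strict inequality survives
     summation. *)
  pose o := Ordinal (ltn_trans s_gt0 (ltn_ord s)).
  have oP : o \in initseg n s by rewrite inE.
  rewrite (bigD1 o) //= [X in _ < X](bigD1 o) //= -addSn leq_add ?lt_l //.
  by apply: leq_sum => l /andP[lP _]; exact/ltnW/lt_l.
have [ik|ki] := leqP i k; last first.
  by move: lt_sum; rewrite /c /ext (leqNgt i k) ki /= !muln0.
have := wilson_middle_bound t_gt0 le_ts wilson Hi ik.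
have k_gt0 : 0 < k - i.-1 by lia.
move: lt_sum; rewrite -(ltn_pmul2l k_gt0) => + mid.
have -> : (k - i.-1) * (a i * (s.+1 - i) * d i) = (s.+1 - i) * (n - s) * (a i * c i).
  by rewrite mulnCA d_diag // [RHS]mulnACA (mulnC (a i)).
have := leq_mul mid (leqnn (a i * c i)); by rewrite mulnAC (mulnC (s * _)) leqNgt => /negP.
Qed.

(** Ties go to the smaller size, so exactly one of two distinct dual sizes is preferred. *)
Let pref i := (a (dual i) * d (dual i) < a i * d i) ||
  ((a (dual i) * d (dual i) == a i * d i) && (i < dual i)).

(* From each pair of layers of dual sizes the heavier one is kept; in the self-dual
   layer, the sets avoiding [l] are kept. *)
Let H l := [set E in G | if (#|E|).*2 == s.+1 + t then l \notin E else pref #|E|].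

(** By [boundary_cover] an offending pair has dual sizes and covers all points: distinct sizes
    cannot both be preferred, and equal sizes leave [l] uncovered. *)
Lemma kept_t_intersecting (l : 'I_n) : l < s -> t_intersecting t.+1 (H l).
Proof.
move=> ls E F /setIdP[EG HE] /setIdP[FG HF]; rewrite ltnNge; apply/negP => le_t.
have [cov cardEF] := boundary_cover EG FG le_t.
have dE : dual #|E| = #|F| by rewrite /dual -cardEF addKn.
have dF : dual #|F| = #|E| by rewrite /dual -cardEF addnK.
move: HE HF; case: ifPn => [/eqP e|ne].
  have -> : (#|F|).*2 == s.+1 + t by apply/eqP; lia.
  move=> lE lF; have : l \in initseg n s.+1 by rewrite inE ltnS ltnW.
  by rewrite -cov inE (negPf lE) (negPf lF).
have -> : ((#|F|).*2 == s.+1 + t) = false by apply/eqP; move/eqP: ne; lia.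
rewrite /pref dE dF; lia.
Qed.

Lemma exists_kept : exists2 l : 'I_n, l < s &
  \sum_(E in G) ext N k #|E| <= \sum_(E in H l) ext (n - s) k #|E|.-1.
Proof.
pose h l i := #|[set E in H l | #|E| == i]|.
have HG l E : E \in H l -> E \in G by case/setIdP.
have [l ls Hl] : exists2 l : 'I_n, l < s &
    forall i, i.*2 = s.+1 + t -> a i * c i <= h l i * d i.
  have hE l i : i.*2 = s.+1 + t -> h l i = #|[set E in G | (#|E| == i) && (l \notin E)]|.
    move=> Hi; apply: eq_card => E; rewrite !inE -!andbA; do 3!congr (_ && _).
    by have [->|_] := eqVneq #|E| _; rewrite ?andbF // Hi eqxx andbT.
  (* For odd [s.+1 + t] there is no self-dual layer, and the point 0 serves as [l]. *)
  have [od|ev] := boolP (odd (s.+1 + t)).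
    have s_gt0 : 0 < s by lia.
    exists (Ordinal (ltn_trans s_gt0 (ltn_ord s))) => // i e.
    by rewrite -e odd_double in od.
  have e : (s.+1 + t)./2.*2 = s.+1 + t by lia.
  have [l ls Hl] := exists_avoided e.
  exists l => // i Hi; have -> : i = (s.+1 + t)./2 by lia.
  by rewrite hE.
exists l => //.
rewrite (sum_by_card (ext N k) card_G) (sum_by_card d (fun E EH => card_G (HG _ _ EH))).
(* Each sum is doubled and one copy reversed, so that the layers [i] and [dual i] are compared
   together. *)
rewrite -leq_double -!addnn {2}big_nat_rev [X in _ <= _ + X]big_nat_rev -!big_split /=.
rewrite big_nat [X in _ <= X]big_nat; apply: leq_sum => i Hi.
have -> : t + s.+2 - i.+1 = dual i by rewrite /dual; lia.
rewrite -/(h l i) -/(h l (dual i)) -/(a i) -/(a (dual i)).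
have [mid|nmid] := eqVneq (i.*2) (s.+1 + t).
  have -> : dual i = i by rewrite /dual; lia.
  by apply: leq_add; exact: Hl.
have hpref j : j.*2 != s.+1 + t -> pref j -> h l j = a j.
  move=> nj pj; apply: eq_card => E; rewrite !inE -!andbA; do 3!congr (_ && _).
  by have [->|_] := eqVneq #|E| _; rewrite ?andbF // (negPf nj) pj.
have dd : dual (dual i) = i by rewrite /dual; lia.
apply: leq_trans (c_pair Hi) _.
have [pi|npi] := boolP (pref i).
  rewrite hpref //; apply: leq_trans (leq_addr _ _); rewrite geq_max leqnn /=.
  by move: pi; rewrite /pref; lia.
have pj : pref (dual i).
  by move: npi nmid; rewrite /pref dd /dual; lia.
rewrite [h l (dual i)]hpref //; last by move: nmid; rewrite /dual; lia.
apply: leq_trans (leq_addl _ _); rewrite geq_max leqnn andbT.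
by move: pj; rewrite /pref dd; lia.
Qed.

Lemma shifted_step : exists V : {set {set 'I_n}},
  [/\ t_intersecting t V, {in V, forall E : {set 'I_n}, E \subset initseg n s} &
      weight k s.+1 U <= weight k s V].
Proof.
have [l ls Hl] := exists_kept.
have HG : H l \subset G by apply/subsetP=> E /setIdP[].
exists (drop_last s U (H l)); split.
- exact: drop_last_t_intersecting HG (kept_t_intersecting ls).
- by apply: drop_last_sub subU _ _; apply/subsetP=> E /(subsetP HG)/GU.
- have := weight_drop_last k HG; lia.
Qed.

End Step.

(* The Erdos-Ko-Rado theorem for t-intersecting families, with Wilson's exact bound on n. *)
Theorem t_intersecting_bound n k t (F : {set {set 'I_n}}) :
  t <= k -> k <= n -> (k - t + 1) * (t + 1) <= n ->
  t_intersecting t F -> {in F, forall E : {set 'I_n}, #|E| = k} ->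
  #|F| <= 'C(n - t, k - t).
Proof.
move=> tk kn wilson tF kF; case: (posnP t) => [t0|t_gt0].
  rewrite t0 !subn0 -[X in 'C(X, _)]card_ord -card_draws subset_leq_card //.
  by apply/subsetP=> E /kF Ek; rewrite inE Ek.
have tn : t <= n by exact: leq_trans tk kn.
have down m : t <= m <= n -> forall U : {set {set 'I_n}}, t_intersecting t U ->
    {in U, forall E : {set 'I_n}, E \subset initseg n m} -> weight k m U <= 'C(n - t, k - t).
  elim: m => [|m IHm] /andP[]; first by lia.
  rewrite leq_eqVlt => /orP[/eqP <- _ | lt_tm lt_mn] U tU subU.
    (* At [m = t] the only possible member is the whole initial segment, whose weight is the
       bound. *)
    have UE : {in U, forall E : {set 'I_n}, E = initseg n t}.
      move=> E EU; apply/eqP; rewrite eqEcard subU //= card_initseg //.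
      by rewrite -(setIid E) tU.
    have /subset_leq_card : U \subset [set initseg n t].
      by apply/subsetP=> E /UE ->; rewrite inE.
    rewrite cards1 /weight (eq_bigr (fun=> 'C(n - t, k - t))) => [|E /UE ->].
      by rewrite sum_nat_const; case: #|U| => [|[]] //; rewrite mul1n.
    by rewrite card_initseg // /ext tk.
  pose s := Ordinal lt_mn.
  have [V [tV subV wV shV]] := @exists_shifted n t s U tU subU.
  have [//|W [tW subW le_w]] := @shifted_step n t k s V t_gt0 _ tk wilson tV subV shV.
  rewrite -wV; apply: leq_trans le_w _; apply: IHm => //; lia.
have <- : weight k n F = #|F|.
  rewrite /weight -sum1_card; apply: eq_bigr => E /kF ->.
  by rewrite /ext leqnn !subnn.
by apply: down; rewrite ?tn ?leqnn // => E _; apply/subsetP=> x; rewrite inE ltn_ord.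
Qed.

(** * Anticodes *)

Lemma sum_card_fibers (T I : finType) (f : T -> I) (X : {set T}) (P : {set I}) :
  {in X, forall x, f x \in P} -> #|X| = \sum_(i in P) #|[set x in X | f x == i]|.
Proof.
move=> XP; rewrite -sum1_card (partition_big f (fun i => i \in P)) //=.
by apply: eq_bigr => i _; rewrite -sum1dep_card.
Qed.

Lemma card_supp q n (S : {set 'I_n}) : 0 < q ->
  #|[set x : word q n | supp x == S]| = (q - 1) ^ #|S|.
Proof.
case: q => // p _; rewrite subSS subn0.
transitivity (#|predC1 (ord0 : 'I_p.+1)| ^ #|S|); last by rewrite cardC1 card_ord.
rewrite -(card_pffun_on ord0); apply: eq_card => x; rewrite inE.
apply/eqP/pffun_onP => [<-|[/subsetP sS imS]].
  split; first by apply/subsetP=> i; rewrite !inE.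
  by move=> _ /imageP[i iS ->]; rewrite inE in iS; rewrite inE.
apply/setP=> i; rewrite inE; apply/idP/idP=> [xi|iS]; first by apply: sS.
by have := imS _ (image_f x iS); rewrite inE.
Qed.

Lemma App_supp q n w t (x : word q n) :
  (x \in App q n w t) = (supp x \subset ~: initseg n t) && (wt x == w).
Proof.
rewrite inE; have -> : [forall i : 'I_n, (i < t) ==> (nat_of_ord (x i) == 0)] =
    (supp x \subset ~: initseg n t).
  apply/forallP/subsetP => [x0 i|sx i].
    by rewrite !inE; apply: contraNN => it; have := x0 i; rewrite it.
  by apply/implyP=> it; apply: contraTT it => xi; have := sx i; rewrite !inE; apply.
case: (boolP (supp x \subset _)) => //= /subsetP sx; congr (_ == _).
apply: eq_card => i; rewrite !inE andbC; case: eqP => //= xi.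
by have := sx i; rewrite !inE -leqNgt; apply; apply/eqP.
Qed.

Lemma card_compl_initseg n m : m <= n -> #|~: initseg n m| = n - m.
Proof. by move=> mn; rewrite cardsCs setCK card_initseg // card_ord. Qed.

Lemma card_App q n w t : 0 < q -> t <= n -> #|App q n w t| = 'C(n - t, w) * (q - 1) ^ w.
Proof.
move=> q0 tn.
pose P := [set S : {set 'I_n} | S \subset ~: initseg n t & #|S| == w].
rewrite (@sum_card_fibers _ _ (@supp q n) _ P); last first.
  by move=> x; rewrite App_supp inE.
rewrite -(card_compl_initseg tn) -cards_draws -sum_nat_const; apply: eq_bigr => S.
rewrite inE => /andP[St /eqP Sw]; rewrite -{2}Sw -(card_supp _ q0).
apply: eq_card => x; rewrite inE App_supp [RHS]inE.
by have [e|] := eqVneq (supp x) S; rewrite ?andbF // /wt e St Sw eqxx.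
Qed.

Lemma App_anticode q n w t : 1 < q -> t + w <= n ->
  is_anticode (Jq q n w) (App q n w t) (n - t).
Proof.
move=> q1 twn; have tn : t <= n by lia.
split.
- rewrite -card_gt0 card_App ?muln_gt0 ?bin_gt0 ?expn_gt0; lia.
- by apply/subsetP=> x; rewrite App_supp inE => /andP[].
move=> x y; rewrite !App_supp => /andP[/subsetP sx _] /andP[/subsetP sy _].
rewrite -(card_compl_initseg tn); apply: subset_leq_card; apply/subsetP=> i.
rewrite inE; apply: contraR => it.
have := contra (sx i) it; have := contra (sy i) it; rewrite !inE !negbK => /eqP yi /eqP xi.
by apply/eqP/val_inj; rewrite /= xi yi.
Qed.

(** * Upper bound on the size of an anticode *)

Lemma card_agree_at q n (S : {set 'I_n}) i (a : 'I_q) : 0 < q -> i \in S ->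
  #|[set x : word q n | (supp x == S) && (x i == a)]| <= (q - 1) ^ #|S|.-1.
Proof.
case: q a => // p a _ iS.
pose z (x : word p.+1 n) : word p.+1 n := [ffun j => if j == i then ord0 else x j].
have -> : #|S|.-1 = #|S :\ i| by rewrite (cardsD1 i S) iS.
rewrite -card_supp // -(card_in_imset (f := z)).
  apply: subset_leq_card; apply/subsetP=> _ /imsetP[x /setIdP[/eqP <- _] ->].
  by rewrite inE; apply/eqP/setP=> j; rewrite !inE ffunE; case: (j == i).
move=> x y; rewrite !inE => /andP[_ /eqP xa] /andP[_ /eqP ya] /ffunP zxy.
apply/ffunP=> j; have := zxy j; rewrite !ffunE; case: eqP => // -> _.
by rewrite xa ya.
Qed.

(** Union bound over the place of agreement. *)
Lemma card_agree_somewhere q n w (S : {set 'I_n}) (y : word q n) (X : {set word q n}) :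
  0 < q -> #|S| = w ->
  {in X, forall x, supp x = S /\ exists2 i, i \in S & x i = y i} ->
  #|X| <= w * (q - 1) ^ w.-1.
Proof.
move=> q0 Sw HX.
apply: (@leq_trans #|\bigcup_(i in S) [set x : word q n | (supp x == S) && (x i == y i)]|).
  apply: subset_leq_card; apply/subsetP=> x /HX[sx [i iS xy]].
  by apply/bigcupP; exists i => //; rewrite inE sx xy !eqxx.
apply: (@leq_trans (\sum_(i in S) (q - 1) ^ w.-1)); last by rewrite sum_nat_const Sw.
elim/big_rec2: _ => [|i m Z iS le_Z]; first by rewrite cards0.
apply: leq_trans (leq_card_setU _ _) _; apply: leq_add le_Z.
by rewrite -Sw card_agree_at.
Qed.

Section Upper.
Variables (q n w t : nat) (B : {set word q n}).
Hypotheses (q_gt0 : 0 < q) (twn : t + w <= n).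
Hypothesis wilson : (n - w - t + 1) * (t + 1) <= n.
Hypothesis anticodeB : is_anticode (Jq q n w) B (n - t).

Definition fiber (S : {set 'I_n}) : {set word q n} := [set x in B | supp x == S].

(** The threshold is the bound of [card_agree_somewhere]: a larger fiber contains a word differing
    from a given [y] everywhere on [S]. *)
Definition large_supports : {set {set 'I_n}} :=
  [set S | w * (q - 1) ^ w.-1 < #|fiber S|].

Lemma anticode_wt x : x \in B -> #|supp x| = w.
Proof. by case: anticodeB => _ /subsetP BJ _ /BJ; rewrite inE => /eqP. Qed.

Lemma anticode_agree x y : x \in B -> y \in B -> t <= #|[set i | x i == y i]|.
Proof.
case: anticodeB => _ _ dB xB yB; have := dB _ _ xB yB; rewrite /hdist.
have -> : [set i | x i == y i] = ~: [set i | x i != y i].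
  by apply/setP=> i; rewrite !inE negbK.
by rewrite [#|~: _|]cardsCs setCK card_ord => /(leq_sub2l n); rewrite subKn //; lia.
Qed.

Lemma large_support_wt S : S \in large_supports -> #|S| = w.
Proof.
rewrite inE => /(leq_ltn_trans (leq0n _))/card_gt0P[x /setIdP[xB /eqP <-]].
exact: anticode_wt.
Qed.

(* Few words supported on [S] agree with [y] at a point of [S], so some word
   of a large fiber agrees with [y] only outside both supports. *)
Lemma large_support_cross S y : S \in large_supports -> y \in B ->
  t <= #|~: S :&: ~: supp y|.
Proof.
move=> SL yB; have Sw := large_support_wt SL.
have [/exists_inP[x /setIdP[xB /eqP xS] /forall_inP xy]|] :=
    boolP [exists x in fiber S, [forall i in S, x i != y i]].
  apply: leq_trans (anticode_agree xB yB) (subset_leq_card _).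
  apply/subsetP=> i; rewrite !inE => /eqP xyi.
  have iS : i \notin S by apply: contraL (introT eqP xyi); exact: xy.
  by rewrite iS -xyi; move: iS; rewrite -xS inE.
move/exists_inPn=> no; move: SL; rewrite inE ltnNge; case/negP.
apply: (@card_agree_somewhere q n w S y) => // x xF.
split; first by case/setIdP: xF => _ /eqP.
by have := no x xF; case/forall_inPn => i iS; rewrite negbK => /eqP; exists i.
Qed.

(** Two distinct members of [G] include a large one, so their complements share [t] points by
    [large_support_cross]; a complement meets itself in [n - w >= t] points. Allowing one exception
    makes room for one further support. *)
Lemma card_large_supports (G : {set {set 'I_n}}) :
  #|G :\: large_supports| <= 1 ->
  {in G, forall S, exists2 y, y \in B & supp y = S} ->
  #|G| <= 'C(n - t, w).
Proof.
move=> G1 GB.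
have GW S : S \in G -> #|S| = w by case/GB=> y yB <-; exact: anticode_wt.
rewrite -(card_imset (mem G) (can_inj (@setCK _))).
have -> : 'C(n - t, w) = 'C(n - t, (n - w) - t).
  by rewrite -bin_sub; [congr ('C(_, _)); lia | lia].
apply: t_intersecting_bound; [lia|lia|exact: wilson| |].
  move=> _ _ /imsetP[S SG ->] /imsetP[S' SG' ->].
  have [SL|SL] := boolP (S \in large_supports).
    by case: (GB _ SG') => y yB <-; exact: large_support_cross.
  have [SL'|SL'] := boolP (S' \in large_supports).
    by rewrite setIC; case: (GB _ SG) => y yB <-; exact: large_support_cross.
  have -> : S' = S by apply: (card_le1_eqP G1); rewrite inE ?SL ?SL'.
  by rewrite setIid cardsCs setCK card_ord GW //; lia.
by move=> _ /imsetP[S SG ->]; rewrite cardsCs setCK card_ord GW.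
Qed.

Lemma anticode_card_le : 2 ^ n * w < q -> #|B| <= 'C(n - t, w) * (q - 1) ^ w.
Proof.
move=> qbig; set M := 'C(n - t, w).
have fib_le (S : {set 'I_n}) : #|S| = w -> #|fiber S| <= (q - 1) ^ w.
  move=> <-; rewrite -card_supp //; apply: subset_leq_card; apply/subsetP=> x.
  by rewrite !inE => /andP[].
have LB S : S \in large_supports -> exists2 y, y \in B & supp y = S.
  rewrite inE => /(leq_ltn_trans (leq0n _))/card_gt0P[x /setIdP[xB /eqP <-]].
  by exists x.
have sumL : \sum_(S in large_supports) #|fiber S| <= #|large_supports| * (q - 1) ^ w.
  by rewrite -sum_nat_const; apply: leq_sum => S /large_support_wt; exact: fib_le.
have [/forall_inP allL|] := boolP [forall x in B, supp x \in large_supports].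
  rewrite (@sum_card_fibers _ _ (@supp q n) B _ allL).
  apply: leq_trans sumL _; rewrite leq_mul2r; apply/orP; right.
  by apply: card_large_supports => //; rewrite setDv cards0.
case/forall_inPn=> y yB yL.
(* Adjoining the support of [y], which is not large, leaves room for one more fiber in the bound. *)
have L1 : #|large_supports|.+1 <= M.
  have <- : #|supp y |: large_supports| = #|large_supports|.+1 by rewrite cardsU1 yL.
  apply: card_large_supports.
    rewrite setDUl setDv setU0; apply: leq_trans (subset_leq_card (subsetDl _ _)) _.
    by rewrite cards1.
  by move=> S /setU1P[->|/LB //]; exists y.
apply: leq_trans (_ : #|large_supports|.+1 * (q - 1) ^ w <= _); last first.
  by rewrite leq_mul2r L1 orbT.
rewrite (@sum_card_fibers _ _ (@supp q n) B setT) // (big_setID large_supports) /= setTI.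
rewrite mulSnr; apply: leq_add sumL _.
(* There are at most [2 ^ n] supports that are not large; as [2 ^ n * w < q], their words number at
   most [(q - 1) ^ w], the size of one full fiber. *)
apply: (@leq_trans (\sum_(S in setT :\: large_supports) w * (q - 1) ^ w.-1)).
  by apply: leq_sum => S; rewrite !inE andbT -leqNgt.
rewrite sum_nat_const; apply: (@leq_trans (2 ^ n * (w * (q - 1) ^ w.-1))).
  rewrite leq_mul2r; apply/orP; right.
  by apply: leq_trans (max_card _) _; rewrite -cardsT -powersetT card_powerset cardsT card_ord.
rewrite mulnA; case: w qbig => [|v] qbig; first by rewrite muln0.
by rewrite expnS leq_mul2r; apply/orP; right; lia.
Qed.

End Upper.

Theorem mainTheorem4 (n w t : nat) (Hnlo : t + w <= n) (Hnhi : n <= 2 * w + t) :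
  (forall q : nat, 3 <= q -> is_anticode (Jq q n w) (App q n w t) (n - t)) /\
  (forall q : nat, 3 <= q -> #|App q n w t| = 'C(n - t, w) * (q - 1) ^ w) /\
  ((n - w - t + 1) * (t + 1) <= n ->
     exists q0 : nat, forall q : nat, 3 <= q -> q0 <= q ->
       is_max_anticode (Jq q n w) (App q n w t) (n - t)).
Proof.
have tn : t <= n by lia.
split; first by move=> q q3; apply: App_anticode => //; lia.
split; first by move=> q q3; apply: card_App => //; lia.
move=> wilson; exists (2 ^ n * w).+1 => q q3 qbig; split; first by apply: App_anticode; lia.
move=> B anticodeB; rewrite card_App //; last by lia.
by apply: anticode_card_le => //; lia.
Qed.
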